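(* Let $k\ge 3$ be fixed. Suppose that $\mathcal{F}\subset\binom{[n]}{k}$ is a $(k,2k)$-conditionally intersecting family. Then $\mathcal{F}$ can be partitioned into two families $\mathcal{H}$ and $\mathcal{B}$, and the ground set $[n]$ can be partitioned into two subsets $Y$ and $Z$, such that the following statements hold. (a) $\mathcal{H}\subset\binom{Y}{k}$ and every set $H\in\mathcal{H}$ contains a unique $(k-1)$-subset. (b) $\mathcal{B}\subset\binom{Z}{k}$ and $\mathcal{B}$ is the vertex-disjoint union of $\frac{|Z|}{k+1}$ copies of complete $k$-graphs on $k+1$ vertices; that is, $Z$ can be partitioned into $\frac{|Z|}{k+1}$ sets of size $k+1$, and $\mathcal{B}$ consists exactly of all $k$-subsets of these sets.
   Context: $[n]=\{1,\ldots,n\}$, and $\binom{V}{k}$ denotes the collection of all $k$-element subsets of $V$. A family $\mathcal{F}\subset\binom{[n]}{k}$ is called $(d,s)$-conditionally intersecting if there do not exist $d$ distinct sets $A_1,\ldots,A_d\in\mathcal{F}$ with $|A_1\cup\cdots\cup A_d|\le s$ and $A_1\cap\cdots\cap A_d=\emptyset$; here $d=k$ and $s=2k$. For a family $\mathcal{H}\subset 2^{[n]}$ and $H\in\mathcal{H}$, a subset $G\subset H$ is called unique if no set of $\mathcal{H}$ other than $H$ contains $G$. The families $\mathcal{H},\mathcal{B}$ and the sets $Y,Z$ are allowed to be empty. *)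

(* Defs.v *)
From mathcomp Require Import all_boot.

Set Implicit Arguments.
Unset Strict Implicit.
Unset Printing Implicit Defensive.

Definition ksubsets (T : finType) (V : {set T}) (k : nat) : {set {set T}} :=
  [set A : {set T} | (A \subset V) && (#|A| == k)].

(* The d distinct sets form a subfamily D of cardinality d.  For D nonempty the
   big intersection, whose neutral element is setT, is the usual one. *)
Definition cond_intersecting (T : finType) (d s : nat) (F : {set {set T}}) : Prop :=
  ~ exists D : {set {set T}},
      [/\ D \subset F, #|D| = d,
          #|\bigcup_(A in D) A| <= s & \bigcap_(A in D) A = set0].

(* Uniqueness is relative to the family HH: "G is an own subset of H". *)
Definition unique_subset (T : finType) (HH : {set {set T}}) (H G : {set T}) : Prop :=
  G \subset H /\ forall H' : {set T}, H' \in HH -> G \subset H' -> H' = H.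

(* A and B split V; unlike in [partition], either part may be empty. *)
Definition bipartition (T : finType) (V A B : {set T}) : Prop :=
  A :|: B = V /\ A :&: B = set0.

(* The blocks in P are the vertex sets of the copies.  As [partition] excludes
   empty blocks, P is set0 exactly when Z is. *)
Definition disjoint_cliques (T : finType) (k : nat) (Z : {set T}) (B : {set {set T}}) : Prop :=
  exists P : {set {set T}},
    [/\ partition P Z,
        forall V : {set T}, V \in P -> #|V| = k.+1,
        #|P| * k.+1 = #|Z|
      & B = \bigcup_(V in P) ksubsets V k].

(* Main.v *)
(** If every (k-1)-subset of an edge A lies in another edge, then for each a in A
    some x a |: A :\ a with x a outside A is an edge.  These k edges have union of
    size at most 2k and no common point in A, so being conditionally intersecting
    forces x to be constant: A extends to a clique on k+1 vertices.  Moreover, an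
    edge E that meets a clique K lies inside it: otherwise E misses two points of
    K, and E together with k-1 suitable k-subsets of K violates the condition.
    Hence the (k+1)-cliques are pairwise disjoint, and disjoint from all edges
    that they do not contain. *)
Require Import Defs.
From mathcomp Require Import all_boot.

Definition cliques {T : finType} (k : nat) (F : {set {set T}}) : {set {set T}} :=
  [set K : {set T} | (#|K| == k.+1) && (ksubsets K k \subset F)].

Lemma ksubsetsS_setD1 {T : finType} {k : nat} {K S : {set T}} :
  #|K| = k.+1 -> S \in ksubsets K k -> exists2 b, b \in K & S = K :\ b.
Proof.
move=> cK; rewrite inE => /andP[sSK /eqP cS].
have : #|K :\: S| == 1 by rewrite cardsD (setIidPr sSK) cK cS subSnn.
case/cards1P => b Kb; exists b.
  by have /setDP[] : b \in K :\: S by rewrite Kb set11.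
by rewrite -Kb setDDr setDv set0U (setIidPr sSK).
Qed.

Lemma setD1_ksubsets {T : finType} (k : nat) (K : {set T}) (b : T) :
  #|K| = k.+1 -> b \in K -> K :\ b \in ksubsets K k.
Proof. by move=> cK bK; rewrite inE subsetDl /= -eqSS -cK (cardsD1 b K) bK. Qed.

Lemma subset_of_card {T : finType} (A : {set T}) (m : nat) :
  m <= #|A| -> exists2 B : {set T}, B \subset A & #|B| = m.
Proof.
move=> lemA; have : 0 < #|[set B : {set T} | B \subset A & #|B| == m]|.
  by rewrite cards_draws bin_gt0.
by case/card_gt0P => B; rewrite inE => /andP[sBA /eqP cB]; exists B.
Qed.

(** If [E] is not inside [K], fix two points [L] of [K :\: E] and take [E] together with the [k.-1]
    sets [K :\ b] for [b] in [K :\: L]. The latter intersect exactly in [L], which misses [E], and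
    everything lies in [E :|: K]. *)
Lemma edge_meeting_clique_sub {T : finType} {k : nat} {F : {set {set T}}}
    {K E : {set T}} :
  0 < k -> F \subset ksubsets [set: T] k -> cond_intersecting k (2 * k) F ->
  K \in cliques k F -> E \in F -> E :&: K != set0 -> E \subset K.
Proof.
move=> k0 /subsetP hF hcond; rewrite inE => /andP[/eqP cK /subsetP sKF] EF EK0.
apply: contraT => nEK; case: hcond.
have cE : #|E| = k by have := hF E EF; rewrite inE => /andP[_ /eqP].
have cEK : #|E :&: K| < k.
  by rewrite -cE proper_card // properE subsetIl subsetI subxx.
(* [E] meets [K] in at most k-1 of its k+1 points, so at least two are left. *)
have [L sLK cL] : exists2 L : {set T}, L \subset K :\: E & #|L| = 2.
  apply: subset_of_card; rewrite cardsD cK setIC leq_subRL.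
    by rewrite addn2.
  by rewrite ltnW // ltnS ltnW.
have [sLK1 dLE] : L \subset K /\ [disjoint L & E].
  by move: sLK; rewrite subsetD => /andP[].
have cKL : #|K :\: L| = k.-1.
  by rewrite cardsD (setIidPr sLK1) cK cL subSS subn1.
pose D' := [set K :\ b | b in K :\: L].
have KD' b : b \in K :\: L -> K :\ b \in D' by apply: imset_f.
have D'K A : A \in D' -> A \subset K.
  by case/imsetP => b _ ->; apply: subsetDl.
exists (E |: D'); split.
- rewrite subUset sub1set EF; apply/subsetP => A /imsetP[b bJ ->].
  by apply/sKF/setD1_ksubsets => //; move: bJ; rewrite in_setD => /andP[].
- rewrite cardsU1 card_in_imset ?cKL; last first.
    move=> b c /setDP[bK _] /setDP[cK' _] /setP/(_ b).
    by rewrite !inE eqxx bK !andbT => /esym/negbFE/eqP.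
  have -> : E \notin D' by apply: contra nEK; apply: D'K.
  by rewrite add1n prednK.
- have sU : \bigcup_(A in E |: D') A \subset E :|: K.
    apply/bigcupsP => A /setU1P[->|/D'K sA]; first exact: subsetUl.
    exact: subset_trans sA (subsetUr _ _).
  apply: leq_trans (subset_leq_card sU) _.
  (* The union has k + (k+1) - #|E :&: K| points, and the common point of [E] and [K] brings this
     down to 2k. *)
  rewrite cardsU cE cK mul2n -addnn leq_subLR addnS.
  by rewrite -add1n leq_add2r card_gt0.
- apply/setP => x; rewrite in_set0; apply/negP => /bigcapP xD.
  have xE : x \in E by apply: xD; rewrite setU11.
  have xL : x \notin L by apply: contraTN xE => xL; rewrite (disjointFr dLE xL).
  (* 0 < #|E :&: K| < k gives k >= 2, so [D'] has a member, which places [x] in [K]. *)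
  have [b bJ] : exists b, b \in K :\: L.
    apply/card_gt0P; rewrite cKL; apply: leq_trans (_ : #|E :&: K| <= _).
      by rewrite card_gt0.
    by rewrite -ltnS prednK.
  have xK : x \in K.
    have /subsetP := D'K _ (KD' b bJ).
    by apply; apply: xD; rewrite in_setU1 KD' ?orbT.
  have := xD (K :\ x); rewrite in_setU1 KD' ?orbT ?in_setD ?xL // => /(_ isT).
  by rewrite !inE eqxx.
Qed.

Lemma trivIset_cliques {T : finType} {k : nat} {F : {set {set T}}} :
  1 < k -> F \subset ksubsets [set: T] k -> cond_intersecting k (2 * k) F ->
  trivIset (cliques k F).
Proof.
move=> k1 hF hcond; apply/trivIsetP => K K' KC K'C.
apply: contra_neqT; rewrite -setI_eq0 => /set0Pn[x /setIP[xK xK']].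
have [/eqP cK _] : #|K| == k.+1 /\ ksubsets K k \subset F.
  by apply/andP; move: KC; rewrite inE.
have [/eqP cK' /subsetP sK'F] : #|K'| == k.+1 /\ ksubsets K' k \subset F.
  by apply/andP; move: K'C; rewrite inE.
apply/esym/eqP; rewrite eqEcard cK cK' leqnn andbT.
apply/subsetP => y yK'.
(* Deleting from [K'] a point [z] other than [x] and [y] leaves an edge that still meets [K] at [x];
   it lies in [K] and carries [y] along. *)
have [z /setDP[zK' zxy]] : exists z, z \in K' :\: [set x; y].
  apply/card_gt0P; rewrite cardsD subn_gt0 cK'.
  apply: leq_ltn_trans (subset_leq_card (subsetIr _ _)) _.
  by rewrite cards2; case: (x != y) => //; rewrite ltnS ltnW.
move: zxy; rewrite !inE negb_or => /andP[zx zy].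
have sub : K' :\ z \subset K.
  apply: (edge_meeting_clique_sub (k := k) (F := F)) => //; first exact: ltnW.
    exact/sK'F/setD1_ksubsets.
  by apply/set0Pn; exists x; rewrite !inE xK xK' eq_sym zx.
by apply: (subsetP sub); rewrite !inE yK' eq_sym zy.
Qed.

Lemma unique_subset_or_clique {T : finType} {k : nat} {F : {set {set T}}}
    {A : {set T}} :
  0 < k -> F \subset ksubsets [set: T] k -> cond_intersecting k (2 * k) F ->
  A \in F ->
  (exists G : {set T}, #|G| = k.-1 /\ unique_subset F A G)
  \/ (exists2 K, K \in cliques k F & A \in ksubsets K k).
Proof.
move=> k0 /subsetP hF hcond AF.
have cF E : E \in F -> #|E| = k by move/hF; rewrite inE => /andP[_ /eqP].
have cA := cF A AF.
have cA1 a : a \in A -> #|A :\ a| = k.-1.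
  by move=> aA; rewrite -cA (cardsD1 a A) aA.
case: (boolP [exists a in A, forall E in F, (A :\ a \subset E) ==> (E == A)]).
  case/exists_inP => a aA /forall_inP uniqA; left; exists (A :\ a).
  split; first exact: cA1.
  split=> [|E EF sE]; first exact: subsetDl.
  by apply/eqP; move: (uniqA E EF); rewrite sE.
move/exists_inPn => nuniq; right.
(* The premise [a \in A] sits under the existential so that [x] becomes a total function, with a
   junk value off [A]. *)
have step a : exists x, a \in A -> x \notin A /\ x |: A :\ a \in F.
  case: (boolP (a \in A)) => [aA|_]; last by exists a.
  have /forall_inPn[E EF] := nuniq a aA.
  rewrite negb_imply => /andP[sE nEA].
  have /subsetPn[x xE xA] : ~~ (E \subset A).
    by apply: contra nEA => sEA; rewrite eqEcard sEA cA (cF E EF) leqnn.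
  exists x => _; split => //.
  suff -> : x |: A :\ a = E by [].
  apply/eqP; rewrite eqEcard subUset sub1set xE sE /= (cF E EF) cardsU1.
  by rewrite !inE (negPf xA) andbF cA1 // add1n prednK.
have [x xP] := fin_all_exists step.
pose D := [set x a |: A :\ a | a in A].
have fD a : a \in A -> x a |: A :\ a \in D.
  by move=> aA; apply: (imset_f (fun a => x a |: A :\ a)).
(* The new edge for [a] has trace [A :\ a] on [A]. Hence these edges are distinct, and no point of
   [A] is common to all of them. *)
have ninA a b : a \in A -> b \in A -> (b \in x a |: A :\ a) = (b != a).
  move=> aA bA; rewrite !inE bA andbT; case: eqP => // bx.
  by have [] := xP a aA; rewrite -bx bA.
case: (set_0Vmem (\bigcap_(E in D) E)) => [cap0|[y /bigcapP yD]].
  case: hcond; exists D; split => //.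
  - by apply/subsetP => _ /imsetP[a aA ->]; have [] := xP a aA.
  - rewrite card_in_imset // => a b aA bA /setP/(_ a).
    by rewrite !ninA // eqxx => /esym/negbFE/eqP.
  - apply: (@leq_trans #|A :|: x @: A|).
      apply/subset_leq_card/bigcupsP => _ /imsetP[a aA ->].
      rewrite subUset sub1set in_setU imset_f // orbT /=.
      exact: subset_trans (subsetDl _ _) (subsetUl _ _).
    rewrite cardsU; apply: leq_trans (leq_subr _ _) _.
    by rewrite mul2n -addnn cA leq_add2l -cA leq_imset_card.
have yA : y \notin A.
  apply/negP => yA; have := yD _ (fD y yA).
  by rewrite ninA // eqxx.
have xy a : a \in A -> x a = y.
  move=> aA; have := yD _ (fD a aA).
  by rewrite !inE (negPf yA) andbF orbF => /eqP.
have cK : #|y |: A| = k.+1 by rewrite cardsU1 yA cA.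
exists (y |: A); last by rewrite inE subsetUr cA eqxx.
(* Deleting [y] from [y |: A] gives back [A]; deleting [b] in [A] gives the new edge for [b], since
   [x b = y]. *)
rewrite inE cK eqxx; apply/subsetP => S /(ksubsetsS_setD1 cK)[b].
case/setU1P => [->|bA] ->; first by rewrite setU1K.
have [_] := xP b bA; rewrite xy //; congr (_ \in F).
rewrite setDUl; congr (_ :|: _); apply/esym/setDidPl.
by rewrite disjoints1 inE; apply: contraNneq yA => ->.
Qed.

Theorem theorem1p7 (k n : nat) (F : {set {set 'I_n}})
  (hk : 3 <= k)
  (hF : F \subset ksubsets [set: 'I_n] k)
  (hcond : cond_intersecting k (2 * k) F) :
  exists (H B : {set {set 'I_n}}) (Y Z : {set 'I_n}),
    [/\ bipartition F H B,
        bipartition [set: 'I_n] Y Z,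
        H \subset ksubsets Y k /\
          (forall A : {set 'I_n}, A \in H ->
             exists G : {set 'I_n}, #|G| = k.-1 /\ unique_subset H A G)
      & B \subset ksubsets Z k /\ disjoint_cliques k Z B].
Proof.
have k1 : 1 < k by apply: ltnW.
have k0 : 0 < k by apply: ltnW.
pose P := cliques k F.
pose B := \bigcup_(V in P) ksubsets V k.
have cP V : V \in P -> #|V| = k.+1 by rewrite inE => /andP[/eqP].
have sBF : B \subset F.
  by apply/bigcupsP => V; rewrite inE => /andP[].
have partP : partition P (cover P).
  rewrite /partition eqxx trivIset_cliques //=.
  by apply/negP => /cP; rewrite cards0.
exists (F :\: B), B, (~: cover P), (cover P); split.
- by split; [rewrite setUC -{2}(setID F B) (setIidPr sBF)
            | rewrite setIC setIDA setIC setDIl setDv setI0].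
- by split; [rewrite setUC setUCr | rewrite setIC setICr].
- split.
    apply/subsetP => A /setDP[AF nAB].
    have : A \in ksubsets [set: 'I_n] k by apply: (subsetP hF).
    rewrite !inE => /andP[_ ->]; rewrite andbT.
    (* An edge outside [B] avoids every clique: if it met one, it would lie inside it and so belong
       to [B]. *)
    rewrite subsetC; apply/bigcupsP => K KP; rewrite subsetC -disjoints_subset.
    rewrite -setI_eq0; apply: contraNT nAB => AK.
    apply/bigcupP; exists K => //; rewrite inE.
    rewrite (edge_meeting_clique_sub k0 hF hcond KP AF AK) /=.
    by have := subsetP hF A AF; rewrite inE => /andP[].
  move=> A /setDP[AF nAB].
  have [[G [cG [sGA uG]]]|[K KP AK]] := unique_subset_or_clique k0 hF hcond AF.
    (* Uniqueness in [F] passes to the subfamily [F :\: B]. *)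
    by exists G; split=> //; split=> // E /setDP[EF _]; apply: uG.
  by case/negP: nAB; apply/bigcupP; exists K.
- split.
    apply/bigcupsP => K KP; apply/subsetP => A; rewrite !inE => /andP[sAK ->].
    by rewrite andbT; apply: subset_trans sAK (bigcup_sup K KP).
  exists P; split => //.
  by rewrite (card_uniform_partition cP partP).
Qed.
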